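(* Let $(a_n)_{n\ge 1}$ be a sequence with $a_n>0$ for all $n$, and let $0<p<1$. Then for any real number $r$ satisfying $(2+r)p\le 1$, $$\sum_{n=1}^{\infty}\Big(\frac{1}{n^r}\sum_{k=n}^{\infty}\Big(\frac{(k+1)^r-k^r}{r}\Big)a_k\Big)^p\ \ge\ \Big(\frac{p}{1-rp}\Big)^p\sum_{n=1}^{\infty}a_n^p .$$ The reversed inequality (with $\le$ in place of $\ge$) holds when $p\ge 1$ and $1/p-2\le r<1/p$, and also when $p<0$ and $1/p-2\le r<1/p$. In each case the constant $\big(p/(1-rp)\big)^p$ is best possible.
   Context: Convention: for $r=0$ the expression $\frac{(k+1)^r-k^r}{r}$ is interpreted as $\ln\frac{k+1}{k}$. All sums have nonnegative terms and take values in $[0,+\infty]$, with $(+\infty)^s=+\infty$ for $s>0$ and $(+\infty)^s=0$ for $s<0$. ''Best possible'' means that, for the given $p$ and $r$, the constant cannot be replaced by a larger one (when the inequality is $\ge$), respectively by a smaller one (when it is $\le$), so that the inequality still holds for all positive sequences $(a_n)$. *)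

(* Defs.v *)
From mathcomp Require Import all_boot all_order all_algebra.
From mathcomp Require Import all_classical all_reals all_analysis.
Import Order.TTheory GRing.Theory Num.Theory.
Set Implicit Arguments.
Unset Strict Implicit.
Unset Printing Implicit Defensive.
Local Open Scope ring_scope.

(* The library's [poweR] sends +oo to +oo for every nonzero exponent;
   for negative exponents we need (+oo)^s = 0 instead. *)
Definition epow (R : realType) (x : \bar R) (s : R) : \bar R :=
  if (x == +oo%E) && (s < 0) then 0%E else poweR x s.

Definition weight (R : realType) (r : R) (k : nat) : R :=
  if r == 0 then ln (k.+1%:R / k%:R)
  else (k.+1%:R `^ r - k%:R `^ r) / r.

(* Sequences are indexed from 1; the value at 0 is never used. *)
Definition positive_seq (R : realType) (a : nat -> R) : Prop :=
  forall n : nat, (1 <= n)%N -> 0 < a n.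

Definition tail_mean (R : realType) (r : R) (a : nat -> R) (n : nat) : \bar R :=
  (((n%:R `^ r)^-1)%:E * \sum_(n <= k <oo) (weight r k * a k)%:E)%E.

Definition mean_sum (R : realType) (p r : R) (a : nat -> R) : \bar R :=
  (\sum_(1 <= n <oo) epow (tail_mean r a n) p)%E.

Definition power_sum (R : realType) (p : R) (a : nat -> R) : \bar R :=
  (\sum_(1 <= n <oo) (a n `^ p)%:E)%E.

Definition lower_bound (R : realType) (p r c : R) : Prop :=
  forall a : nat -> R, positive_seq a ->
    (mean_sum p r a >= c%:E * power_sum p a)%E.

Definition upper_bound (R : realType) (p r c : R) : Prop :=
  forall a : nat -> R, positive_seq a ->
    (mean_sum p r a <= c%:E * power_sum p a)%E.

Definition best_lower_bound (R : realType) (p r c : R) : Prop :=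
  lower_bound p r c /\ forall c' : R, c < c' -> ~ lower_bound p r c'.

Definition best_upper_bound (R : realType) (p r c : R) : Prop :=
  upper_bound p r c /\ forall c' : R, c' < c -> ~ upper_bound p r c'.

(* Main.v *)
Require Import Defs.
From mathcomp Require Import all_boot all_order all_algebra.
From mathcomp Require Import all_classical all_reals all_analysis.
From mathcomp Require Import ring lra.
Import Order.TTheory GRing.Theory Num.Theory.
Import numFieldNormedType.Exports.
Set Implicit Arguments.
Unset Strict Implicit.
Unset Printing Implicit Defensive.
Local Open Scope ring_scope.

(* Put b = 1/p - r, so that the constant is b^-p, and let
     A_n = sum_(k >= n) weight r k * a_k,  f_n = n^-r A_n,
     S_n = sum_(k <= n) k^(b-1),  u_n = n^-((1-p)b) A_n^p,
   so that f_n^p = (S_n - S_(n-1)) u_n.  As weight r n is the integral of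
   x^(r-1) over [n, n+1], A extends to a continuous function that solves
   A' = - x^(r-1) a_n there.  Differentiating x^-((1-p)b) A^p and applying
   Bernoulli's inequality to (a/(b f))^p gives
     u_n - u_(n+1) <= b^(1-p) a_n^p I_n,  I_n = int_n^(n+1) x^-b dx
   for p < 0 or p >= 1, and the reverse for 0 < p < 1.  The inequality of Levin
   and Steckin, b S_n I_n <= 1 for b <= 2 and >= 1 for b >= 2, turns this into
   S_n (u_n - u_(n+1)) <= b^-p a_n^p (resp. >=), and summation by parts
   concludes up to a boundary term S_N u_(N+1).  That term has the right sign
   for 0 < p < 1; for p >= 1 it is removed by truncating the tails, and for
   p < 0 it tends to 0 because A_N is bounded below through the block
   N <= k < 2N.  For optimality, choose a so that A_n = n^(r - (1+h)/p)
   exactly and let h tend to 0. *)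

(** * Mean value theorem, real powers and Bernoulli's inequality *)

Lemma closed_MVT (R : realType) (f df : R -> R) (a b : R) : a <= b ->
  (forall x, a <= x <= b -> is_derive x 1 f (df x)) ->
  exists2 c, a <= c <= b & f b - f a = df c * (b - a).
Proof.
move=> ab fdf.
have [||c cab ->] := @MVT_segment R f df a b ab.
- by move=> x; rewrite in_itv/= => /andP[/ltW ax /ltW xb]; apply: fdf; rewrite ax.
- apply: derivable_within_continuous => x; rewrite in_itv/= => xab.
  by apply: ex_derive; exact: fdf.
- by exists c => //; move: cab; rewrite in_itv.
Qed.

Lemma powRDp (R : realType) (x r s : R) : 0 < x ->
  x `^ (r + s) = x `^ r * x `^ s.
Proof. by move=> x0; rewrite powRD// (gt_eqF x0) implybT. Qed.

Lemma powR_pred (R : realType) (e x : R) : 0 < x ->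
  x `^ e = x * x `^ (e - 1).
Proof.
move=> x0; rewrite -{2}(powRr1 (ltW x0)) -powRDp//.
by congr powR; rewrite addrC subrK.
Qed.

Lemma powR_sub1_ge0 (R : realType) (e t : R) : 1 <= t -> 0 <= e * (t `^ e - 1).
Proof.
move=> t1; have [e0|e0] := leP 0 e.
  by rewrite mulr_ge0// subr_ge0 -(powRr0 t) ler_powR.
by rewrite mulr_le0 ?(ltW e0)// subr_le0 -(powRr0 t) ler_powR// ltW.
Qed.

Lemma powR_sub1_le0 (R : realType) (e t : R) : 0 < t <= 1 ->
  e * (t `^ e - 1) <= 0.
Proof.
move=> t01; have [e0|e0] := leP 0 e.
  by rewrite mulr_ge0_le0// subr_le0 -(powRr0 t) ger_powR.
by rewrite mulr_le0_ge0 ?(ltW e0)// subr_ge0 -(powRr0 t) ger_powR// ltW.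
Qed.

(* The library states these rules for [f + g], [f * g] and so on, which do not
   unify with the body of an explicit function. *)
Section pointwise_derivatives.
Variable R : realType.
Implicit Types (f g : R -> R) (x c e : R).

Lemma is_derive_add f g x df dg :
  is_derive x (1 : R) f df -> is_derive x (1 : R) g dg ->
  is_derive x (1 : R) (fun y => f y + g y) (df + dg).
Proof. exact: is_deriveD. Qed.

Lemma is_derive_opp f x df :
  is_derive x (1 : R) f df -> is_derive x (1 : R) (fun y => - f y) (- df).
Proof. exact: is_deriveN. Qed.

Lemma is_derive_mul f g x df dg :
  is_derive x (1 : R) f df -> is_derive x (1 : R) g dg ->
  is_derive x (1 : R) (fun y => f y * g y) (f x * dg + g x * df).
Proof. exact: is_deriveM. Qed.

Lemma is_derive_const c x : is_derive x (1 : R) (fun=> c) 0.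
Proof. exact: is_derive_cst. Qed.

Lemma is_derive_var x : is_derive x (1 : R) (fun y => y) 1.
Proof. exact: is_derive_id. Qed.

Lemma is_derive_powR f x df e : 0 < f x -> is_derive x (1 : R) f df ->
  is_derive x (1 : R) (fun y => f y `^ e) (e * f x `^ (e - 1) * df).
Proof. by move=> f0 fx; exact: (is_derive1_comp (is_derive1_powR e f0) fx). Qed.

End pointwise_derivatives.

Ltac differentiate :=
  notypeclasses refine (is_derive_eq _ _);
  [ repeat first
    [ eassumption
    | notypeclasses refine (is_derive_const _ _)
    | notypeclasses refine (is_derive_var _)
    | notypeclasses refine (is_derive_add _ _)
    | notypeclasses refine (is_derive_opp _)
    | notypeclasses refine (is_derive_mul _ _)
    | notypeclasses refine (is_derive_powR _ _ _) ] | ];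
  rewrite /=.

(** The factor [p * (p - 1)] has the sign of the second derivative of x^p, so one statement covers
    the convex and the concave range: the graph stays on one side of its tangent at 1. The mean
    value theorem between 1 and [t] reduces this to the sign of c^(p-1) - 1. *)
Lemma powR_bernoulli (R : realType) (p t : R) : 0 < t ->
  0 <= p * (p - 1) * (t `^ p - 1 - p * (t - 1)).
Proof.
move=> t0; pose h (x : R) := x `^ p - p * x; pose g (x : R) := p * (x `^ (p - 1) - 1).
have dh (x : R) : 0 < x -> is_derive x (1 : R) h (g x).
  move=> x0; rewrite /h /g; differentiate; ring.
have -> : t `^ p - 1 - p * (t - 1) = h t - h 1 by rewrite /h powR1; ring.
have [t1|/ltW t1] := leP 1 t.
  have [x /andP[x1 _]|c /andP[c1 _] ->] := closed_MVT t1 (df := g) (f := h).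
    by apply: dh; lra.
  have H := powR_sub1_ge0 (p - 1) c1; rewrite /g.
  have -> : p * (p - 1) * (p * (c `^ (p - 1) - 1) * (t - 1)) =
     p ^+ 2 * ((p - 1) * (c `^ (p - 1) - 1)) * (t - 1) by ring.
  by rewrite mulr_ge0 ?subr_ge0// mulr_ge0 ?sqr_ge0.
have [x /andP[x1 _]|c /andP[c1 c2]] := closed_MVT t1 (df := g) (f := h).
  by apply: dh; lra.
rewrite -opprB => /eqP; rewrite eqr_oppLR => /eqP ->.
have H : (p - 1) * (c `^ (p - 1) - 1) <= 0.
  by apply: powR_sub1_le0; rewrite c2 (lt_le_trans t0 c1).
rewrite /g; have -> : p * (p - 1) * - (p * (c `^ (p - 1) - 1) * (1 - t)) =
   p ^+ 2 * - ((p - 1) * (c `^ (p - 1) - 1)) * (1 - t) by ring.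
by rewrite mulr_ge0 ?subr_ge0// mulr_ge0 ?sqr_ge0 ?oppr_ge0.
Qed.

(* At [x = 1 / n] and [h = b - 1] this is the induction step
   [1 / I_n - 1 / I_(n-1) >= b * n `^ (b - 1)] (resp. [<=]) of the Levin-Steckin
   inequality, cleared of denominators. *)
Lemma levin_steckin_aux (R : realType) (h x : R) : -1 < h -> 0 <= x < 1 ->
  0 <= (h - 1) * ((1 + x) `^ h + (1 - x) `^ h
                  + (h - 1) * ((1 + x) `^ h * (1 - x) `^ h) - (1 + h)).
Proof.
move=> h1 /andP[x0 x1].
(* The derivative of [F] below is h(h-1)(1-y^2)^(h-1) times [G]. Both [F] and [G] vanish at 0, so
   two applications of the mean value theorem settle the sign. *)
pose G (y : R) := (1 - y) `^ (1 - h) - (1 + y) `^ (1 - h) + 2 * (1 - h) * y.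
pose dG (y : R) := (h - 1) * ((1 - y) `^ (- h) + (1 + y) `^ (- h) - 2).
have dGE (y : R) : 0 <= y < 1 -> is_derive y (1 : R) G (dG y).
  move=> /andP[y0 y1].
  have p1 : 0 < 1 - y by lra.
  have p2 : 0 < 1 + y by lra.
  have e : 1 - h - 1 = - h by ring.
  rewrite /G /dG -e.
  by rewrite /G /dG; differentiate; rewrite ?e; first [lra | ring].
have Gsign (y : R) : 0 <= y < 1 -> 0 <= h * (h - 1) * G y.
  move=> /andP[y0 y1].
  have [z /andP[z0 zy]|c /andP[c0 cy]] := closed_MVT y0 (df := dG) (f := G).
    by apply: dGE; rewrite z0 (le_lt_trans zy).
  have -> : G 0 = 0 by rewrite /G subr0 addr0 powR1; ring.
  rewrite !subr0 => ->; rewrite mulrA mulr_ge0// /dG.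
  have p1 : 0 < 1 - c by lra.
  have p2 : 0 < 1 + c by lra.
  (* Adding the Bernoulli defects at [1 - c] and [1 + c] cancels the linear terms; [-1 < h] then
     allows the factor [h + 1] to be dropped. *)
  have := powR_bernoulli (- h) p1; have := powR_bernoulli (- h) p2.
  set u := _ `^ _; set v := _ `^ _ => B1 B2.
  have {B1 B2} : 0 <= h * (h + 1) * (u + v - 2).
    apply: le_trans (addr_ge0 B1 B2) _; rewrite le_eqVlt; apply/orP; left.
    by apply/eqP; ring.
  have h10 : 0 < h + 1 by lra.
  rewrite mulrAC pmulr_lge0// {dGE} => H.
  have -> : h * (h - 1) * ((h - 1) * (v + u - 2)) =
    (h - 1) ^+ 2 * (h * (u + v - 2)) by ring.
  by rewrite mulr_ge0 ?sqr_ge0.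
pose F (y : R) := (h - 1) * ((1 + y) `^ h + (1 - y) `^ h
                  + (h - 1) * ((1 + y) `^ h * (1 - y) `^ h) - (1 + h)).
pose dF (y : R) := h * (h - 1) * G y * ((1 + y) `^ (h - 1) * (1 - y) `^ (h - 1)).
have dFE (y : R) : 0 <= y <= x -> is_derive y (1 : R) F (dF y).
  move=> /andP[y0 yx].
  have p1 : 0 < 1 - y by lra.
  have p2 : 0 < 1 + y by lra.
  rewrite /F /dF /G; differentiate; [lra..|].
  have e0 : 1 - h + (h - 1) = 0 by ring.
  have E1 := powR_pred h p2.
  have E2 := powR_pred h p1.
  have E3 : (1 + y) `^ (1 - h) * (1 + y) `^ (h - 1) = 1.
    by rewrite -powRDp// e0 powRr0.
  have E4 : (1 - y) `^ (1 - h) * (1 - y) `^ (h - 1) = 1.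
    by rewrite -powRDp// e0 powRr0.
  rewrite E1 E2; move: E3 E4; set a := _ `^ _; set b := _ `^ _; set c := _ `^ _.
  set d := _ `^ _ => E3 E4.
  transitivity (h * (h - 1) * (b * (c * d) - d * (a * b)
     + 2 * (1 - h) * y * b * d)); last by ring.
  by rewrite E3 E4; ring.
have [c /andP[c0 cx]] := closed_MVT x0 dFE.
have -> : F 0 = 0 by rewrite /F subr0 addr0 powR1; ring.
rewrite !subr0 {1}/F => ->; rewrite /dF mulr_ge0// mulr_ge0//; last first.
  by rewrite mulr_ge0 ?powR_ge0.
by apply: Gsign; rewrite c0 (le_lt_trans cx x1).
Qed.

(** * Weights and the Levin-Steckin inequality *)

Definition weight_primitive (R : realType) (s t : R) : R :=
  if s == 0 then ln t else t `^ s / s.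

Lemma is_derive_weight_primitive (R : realType) (s x : R) : 0 < x ->
  is_derive x (1 : R) (weight_primitive s) (x `^ (s - 1)).
Proof.
move=> x0; rewrite /weight_primitive; have [->|s0] := eqVneq s 0.
  by rewrite sub0r powR_inv1 ?ltW//; exact: is_derive1_ln.
by differentiate => //; field.
Qed.

Lemma weightE (R : realType) (s : R) k : (0 < k)%N ->
  weight s k = weight_primitive s k.+1%:R - weight_primitive s k%:R.
Proof.
move=> k0; rewrite /weight /weight_primitive; case: eqP => [_|_]; last by ring.
by rewrite ln_div// posrE ltr0n.
Qed.

Lemma weight_gt0 (R : realType) (s : R) k : (0 < k)%N -> 0 < weight s k.
Proof.
move=> k0; rewrite weightE//.
have kk : k%:R <= k.+1%:R :> R by rewrite ler_nat.
have [|c /andP[kc _] ->] := closed_MVT kk (f := weight_primitive s)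
    (df := fun x => x `^ (s - 1)).
  move=> x /andP[kx _]; apply: is_derive_weight_primitive.
  by apply: lt_le_trans kx; rewrite ltr0n.
rewrite -natrB// subSnn mulr1 powR_gt0//.
by apply: lt_le_trans kc; rewrite ltr0n.
Qed.

Lemma weight1 (R : realType) k : (0 < k)%N -> weight 1 k = 1 :> R.
Proof.
move=> k0; rewrite /weight oner_eq0 !powRr1// divr1.
by rewrite -natrB// subSnn.
Qed.

(** Raising the exponent by [d] multiplies the integrand x^(s-1) on [k, k+1] by x^d, which lies
    between its values at the endpoints. *)
Lemma weight_shift (R : realType) (s d : R) k : (0 < k)%N -> 0 <= d ->
  k%:R `^ d * weight s k <= weight (s + d) k <= k.+1%:R `^ d * weight s k.
Proof.
move=> k0 d0.
have kp : 0 < k%:R :> R by rewrite ltr0n.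
have kk : k%:R <= k.+1%:R :> R by rewrite ler_nat.
(* One mean value point must serve both weights, so the theorem is applied to the combination of
   primitives with coefficient [C], later an endpoint value of x^d. *)
have mvt C : exists2 c, k%:R <= c <= k.+1%:R &
    weight (s + d) k - C * weight s k = c `^ (s - 1) * (c `^ d - C).
  pose h (x : R) := weight_primitive (s + d) x - C * weight_primitive s x.
  have [|c /andP[kc ck] E] := closed_MVT kk (f := h)
      (df := fun x => x `^ (s - 1) * (x `^ d - C)).
    move=> x /andP[kx _]; have x0 := lt_le_trans kp kx.
    have H1 := is_derive_weight_primitive (s + d) x0.
    have H2 := is_derive_weight_primitive s x0.
    rewrite /h; differentiate.
    have -> : s + d - 1 = s - 1 + d by ring.
    by rewrite powRDp//; ring.
  exists c; first by rewrite kc.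
  rewrite !weightE//; move: E; rewrite /h -natrB// subSnn mulr1 => <-; ring.
apply/andP; split.
  have [c /andP[kc _] E] := mvt (k%:R `^ d).
  rewrite -subr_ge0 E mulr_ge0 ?powR_ge0// subr_ge0.
  by apply: ge0_ler_powR => //; rewrite nnegrE ltW// (lt_le_trans kp).
have [c /andP[kc ck] E] := mvt (k.+1%:R `^ d).
rewrite -subr_le0 E mulr_ge0_le0 ?powR_ge0// subr_le0.
by apply: ge0_ler_powR => //; rewrite nnegrE ltW// (lt_le_trans kp).
Qed.

(** Writing the neighbours of N = n+2 as N(1 - 1/N) and N(1 + 1/N) makes all powers of N cancel;
    what remains is the expression of [levin_steckin_aux] over a positive denominator. *)
Lemma levin_steckin_step (R : realType) (b : R) n : 0 < b -> b != 1 ->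
  0 <= (b - 2) * (weight (1 - b) n.+2 / weight (1 - b) n.+1
                  + b * n.+2%:R `^ (b - 1) * weight (1 - b) n.+2 - 1).
Proof.
move=> b0 b1; set N : R := n.+2%:R.
have N0 : 0 < N by rewrite ltr0n.
have ME : n.+1%:R = N * (1 - N^-1).
  by rewrite mulrBr mulr1 divff ?gt_eqF// /N -[in RHS]natr1 addrK.
have PE : n.+3%:R = N * (1 + N^-1).
  by rewrite mulrDr mulr1 divff ?gt_eqF// /N natr1.
have x0 : 0 < N^-1 by rewrite invr_gt0.
have x1 : N^-1 < 1 by rewrite invf_lt1// ltr1n.
set h := b - 1.
have h0 : h != 0 by rewrite subr_eq0.
have hE : 1 - b = - h by rewrite /h; ring.
have hN : (1 - b == 0) = false by rewrite hE oppr_eq0; exact/negbTE.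
have h1 : -1 < h by rewrite /h; lra.
have x01 : 0 <= N^-1 < 1 by rewrite ltW.
have H := levin_steckin_aux h1 x01.
have p1 : 0 < 1 + N^-1 by rewrite addr_gt0.
have p2 : 0 < 1 - N^-1 by rewrite subr_gt0.
have w1 := weight_gt0 (1 - b) (ltn0Sn n).
move: w1 H; rewrite /weight hN hE ME PE -/N !powRN.
rewrite !powRM ?(ltW p1) ?(ltW p2) ?(ltW N0)//.
have A0 : 0 < (1 + N^-1) `^ h by rewrite powR_gt0.
have B0 : 0 < (1 - N^-1) `^ h by rewrite powR_gt0.
have C0 : 0 < N `^ h by rewrite powR_gt0.
move: A0 B0 C0; set A := (1 + _) `^ _; set B := (1 - _) `^ _; set C := N `^ h.
move=> A0 B0 C0 w1 H.
have An : A != 0 by rewrite gt_eqF.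
have Bn : B != 0 by rewrite gt_eqF.
have Cn : C != 0 by rewrite gt_eqF.
(* The sign is read off from the positivity of the weight at n+1, which avoids a case split on the
   sign of [h]. *)
have hB : 0 < h * (1 - B).
  have -> : h * (1 - B) = (C^-1 - (C * B)^-1) / - h * (C * B * h ^+ 2).
    by field; rewrite h0 Bn Cn.
  by rewrite pmulr_rgt0// pmulr_rgt0 ?exprn_even_gt0 ?mulr_gt0.
have Bn1 : 1 - B != 0 by apply: contraTneq hB => ->; rewrite mulr0 ltxx.
have bE : b = h + 1 by rewrite /h subrK.
rewrite (_ : _ * _ = (h - 1) * (A + B + (h - 1) * (A * B) - (1 + h)) /
   (A * (h * (1 - B)))).
  by rewrite divr_ge0// mulr_ge0// ltW.
rewrite {1 2}bE. field.
by rewrite Bn1 h0 An Cn Bn -oppr_eq0 opprB Bn1.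
Qed.

(** Induction on [n]: the new defect is the old one times the ratio of consecutive weights, plus the
    quantity of [levin_steckin_step]. At b = 1 the weight is a logarithm and ln(1+x) <= x
    suffices. *)
Lemma levin_steckin (R : realType) (b : R) n : 0 < b ->
  0 <= (b - 2) * (b * (\sum_(1 <= k < n.+2) k%:R `^ (b - 1))
                  * weight (1 - b) n.+1 - 1).
Proof.
move=> b0; have [b1|b1] := eqVneq b 1.
  rewrite b1 subrr; under eq_bigr do rewrite powRr0.
  rewrite sumr_const_nat subn1/= mul1r /weight eqxx.
  have n0 : 0 < n.+1%:R :> R by rewrite ltr0n.
  have -> : n.+2%:R / n.+1%:R = 1 + n.+1%:R^-1 :> R.
    by rewrite -natr1 mulrDl mul1r divff// gt_eqF.
  have : ln (1 + n.+1%:R^-1) <= n.+1%:R^-1 :> R.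
    by apply: le_ln1Dx; rewrite (lt_trans (ltrN10 _))// invr_gt0.
  rewrite -(ler_pM2l n0) mulfV ?gt_eqF//; lra.
elim: n => [|n IH].
  rewrite big_nat1 powR1 mulr1 /weight powR1.
  rewrite subr_eq0 eq_sym (negbTE b1).
  (* The base case is Bernoulli's inequality at t = 2 with exponent b - 1. *)
  have := @powR_bernoulli R (b - 1) 2%:R (ltr0n _ _).
  have -> : 1 - b = - (b - 1) by ring.
  rewrite powRN.
  have := @powR_gt0 R 2%:R (b - 1) (ltr0n _ _); set u := _ `^ _ => u0 H.
  have b10 : b - 1 != 0 by rewrite subr_eq0.
  rewrite (_ : _ * _ = (b - 1) * (b - 1 - 1) * (u - 1 - (b - 1) * (2%:R - 1)) /
     (u * (b - 1) ^+ 2)).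
    by rewrite divr_ge0// mulr_ge0 ?sqr_ge0// ltW.
  by field; rewrite b10 gt_eqF.
rewrite big_nat_recr//=.
have := levin_steckin_step n b0 b1.
have w1 := weight_gt0 (1 - b) (ltn0Sn n).
have w2 := weight_gt0 (1 - b) (ltn0Sn n.+1).
move: IH w1 w2; set S := \sum_(_ <= _ < _) _.
set v := weight _ n.+1; set w := weight _ n.+2.
move=> IH w1 w2 H.
rewrite (_ : _ * _ = (b - 2) * (b * S * v - 1) * (w / v) +
    (b - 2) * (w / v + b * n.+2%:R `^ (b - 1) * w - 1)).
  by rewrite addr_ge0// mulr_ge0// ltW// divr_gt0.
by field; rewrite gt_eqF.
Qed.

(** * Telescoping *)

Lemma bernoulli_ge (R : realType) (p t : R) : p < 0 \/ 1 <= p -> 0 < t ->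
  0 <= 1 * (t `^ p - 1 - p * (t - 1)).
Proof.
move=> p01 t0; rewrite mul1r; have [->|p1] := eqVneq p 1.
  by rewrite powRr1 ?(ltW t0)// mul1r subrr.
have := powR_bernoulli p t0; rewrite pmulr_rge0//.
case: p01 => p0; first by rewrite nmulr_rgt0//; lra.
by rewrite mulr_gt0 ?(lt_le_trans ltr01 p0)// subr_gt0 lt_neqAle eq_sym p1.
Qed.

Lemma bernoulli_le (R : realType) (p t : R) : 0 < p < 1 -> 0 < t ->
  0 <= - 1 * (t `^ p - 1 - p * (t - 1)).
Proof.
move=> /andP[p0 p1] t0; rewrite mulN1r oppr_ge0.
by have := powR_bernoulli p t0; rewrite nmulr_rge0// pmulr_rlt0// subr_lt0.
Qed.

(** At b = 2 the factor [b - 2] makes [levin_steckin] empty. This is the equality case, where both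
    one-sided forms hold. *)
Lemma levin_steckin2 (R : realType) n :
  2 * (\sum_(1 <= k < n.+2) k%:R `^ (2 - 1)) * weight (1 - 2) n.+1 = 1 :> R.
Proof.
have e1 : 2 - 1 = 1 :> R by lra.
have e2 : 1 - 2 = - 1 :> R by lra.
rewrite e1 e2.
have -> : \sum_(1 <= k < n.+2) k%:R `^ 1 = n.+1%:R * n.+2%:R / 2 :> R.
  elim: n => [|n IH]; first by rewrite big_nat1 powR1; field.
  by rewrite big_nat_recr//= IH powRr1// -!(natr1 n.+1) -!(natr1 n.+2) -?natr1; field.
rewrite /weight oppr_eq0 oner_eq0 !powR_inv1// -(natr1 n.+1).
by field; rewrite nat1r natr1 !pnatr_eq0.
Qed.

Lemma levin_steckin_le (R : realType) (b : R) n : 0 < b <= 2 ->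
  0 <= 1 * (1 - b * (\sum_(1 <= k < n.+2) k%:R `^ (b - 1))
                  * weight (1 - b) n.+1).
Proof.
move=> /andP[b0 b2]; rewrite mul1r; have [->|b2'] := eqVneq b 2.
  by rewrite levin_steckin2 subrr.
have := levin_steckin n b0; rewrite nmulr_rge0 ?subr_le0 ?subr_ge0//.
by rewrite subr_lt0 lt_neqAle b2'.
Qed.

Lemma levin_steckin_ge (R : realType) (b : R) n : 2 <= b ->
  0 <= - 1 * (1 - b * (\sum_(1 <= k < n.+2) k%:R `^ (b - 1))
                  * weight (1 - b) n.+1).
Proof.
move=> b2; rewrite mulN1r opprB; have [->|b2'] := eqVneq b 2.
  by rewrite levin_steckin2 subrr.
have b0 : 0 < b by apply: lt_le_trans b2; lra.
have := levin_steckin n b0; rewrite pmulr_rge0//.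
by rewrite subr_gt0 lt_neqAle eq_sym b2'.
Qed.

(* The sign [e] is 1 for the upper bounds and -1 for the lower bound. *)
Section telescoping.
Variables (R : realType) (p r b e : R).
Hypotheses (p0 : p != 0) (b0 : 0 < b) (rE : r = p^-1 - b).
Hypothesis bern : forall t : R, 0 < t -> 0 <= e * (t `^ p - 1 - p * (t - 1)).

(* With [A t = B + a * \int_t^(n+1) x `^ (r - 1)] and [f = t `^ (- r) * A t],
   the derivative of [t `^ (- (1 - p) * b) * (A t) `^ p], augmented by
   [b * (a / b) `^ p * t `^ (- b)], is [t `^ (- b) * b * f `^ p] times the
   Bernoulli defect at [a / (b * f)]. *)
Lemma one_step (a B : R) n : (0 < n)%N -> 0 < a -> 0 < B ->
  0 <= e * (b * (b `^ (- p) * a `^ p) * weight (1 - b) n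
            - (n%:R `^ (- ((1 - p) * b)) * (weight r n * a + B) `^ p
               - n.+1%:R `^ (- ((1 - p) * b)) * B `^ p)).
Proof.
move=> n0 a0 B0.
have kp : 0 < n%:R :> R by rewrite ltr0n.
have kk : n%:R <= n.+1%:R :> R by rewrite ler_nat.
pose A (t : R) := B + a * (weight_primitive r n.+1%:R - weight_primitive r t).
have A0 (t : R) : n%:R <= t <= n.+1%:R -> 0 < A t.
  move=> /andP[nt tn]; rewrite ltr_wpDr// mulr_ge0 ?(ltW a0)//.
  have [x /andP[tx _]|c _ ->] := closed_MVT tn (f := weight_primitive r)
     (df := fun x => x `^ (r - 1)).
    by apply: is_derive_weight_primitive; exact: lt_le_trans (lt_le_trans kp nt) tx.
  by rewrite mulr_ge0 ?powR_ge0// subr_ge0.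
pose k := (1 - p) * b.
pose K := b * (b `^ (- p) * a `^ p).
pose h (t : R) := t `^ (- k) * A t `^ p + K * weight_primitive (1 - b) t.
pose y (t : R) := a * t `^ r / (b * A t).
pose dh (t : R) := b * t `^ (- b) * (t `^ (- r) * A t) `^ p *
  (y t `^ p - 1 - p * (y t - 1)).
have dhE (t : R) : n%:R <= t <= n.+1%:R -> is_derive t (1 : R) h (dh t).
  move=> nt; have At := A0 t nt; move/andP: nt => [nt _].
  have t0 := lt_le_trans kp nt.
  have H1 := is_derive_weight_primitive r t0.
  have H2 := is_derive_weight_primitive (1 - b) t0.
  rewrite /h /A; differentiate => //; rewrite -/(A t).
  rewrite /dh /y.
  rewrite !powRM ?powR_ge0 ?invr_ge0 ?mulr_ge0 ?(ltW a0) ?(ltW b0) ?(ltW At) ?powR_ge0//.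
  have inv x : 0 < x -> x^-1 `^ p = (x `^ p)^-1.
    by move=> x0; rewrite -powRN -powR_inv1 ?ltW// -powRrM mulN1r.
  rewrite inv ?mulr_gt0// powRM ?(ltW b0) ?(ltW At)//.
  have eT : t `^ (- k - 1) = t `^ (- k) / t.
    by rewrite powRDp// powR_inv1 ?ltW.
  have eX : t `^ (r - 1) = t `^ r / t by rewrite powRDp// powR_inv1 ?ltW.
  have eA : A t `^ (p - 1) = A t `^ p / A t by rewrite powRDp// powR_inv1 ?ltW.
  (* The relation between [r], [p] and [b] enters here: -b = -k + rp - 1. *)
  have eb : t `^ (- b) = t `^ (- k) * (t `^ r) `^ p / t.
    rewrite -powRrM -(powR_inv1 (ltW t0)) -!powRDp//; congr powR.
    by rewrite /k rE; field.
  have er : (t `^ (- r)) `^ p = ((t `^ r) `^ p)^-1 by rewrite powRN inv// powR_gt0.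
  have e1 : 1 - b - 1 = - b by ring.
  rewrite e1 eT eX eA er eb /K powRN.
  have : t `^ (- k) != 0 by rewrite gt_eqF// powR_gt0.
  have : t `^ r != 0 by rewrite gt_eqF// powR_gt0.
  have : (t `^ r) `^ p != 0 by rewrite gt_eqF// !powR_gt0.
  have : A t `^ p != 0 by rewrite gt_eqF// !powR_gt0.
  have : b `^ p != 0 by rewrite gt_eqF// !powR_gt0.
  have : a `^ p != 0 by rewrite gt_eqF// !powR_gt0.
  have : A t != 0 by rewrite gt_eqF.
  have : t != 0 by rewrite gt_eqF.
  have : b != 0 by rewrite gt_eqF.
  rewrite /k.
  set T := t `^ _; set X := t `^ r; set U := X `^ p.
  set C := A t `^ p; set D := b `^ p; set E := a `^ p.
  move: (A t) => At' z1 z2 z3 z4 z5 z6 z7 z8 z9; field.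
  by rewrite ?z1 ?z2 ?z3 ?z4 ?z5 ?z6 ?z7 ?z8 ?z9.
have [c nc E] := closed_MVT kk dhE.
have -> : K * weight (1 - b) n -
   (n%:R `^ (- k) * (weight r n * a + B) `^ p - n.+1%:R `^ (- k) * B `^ p) =
   h n.+1%:R - h n%:R.
  by rewrite /h /A subrr mulr0 addr0 !weightE//
    [in X in _ = _ - (_ * X `^ p + _)]addrC [a * _]mulrC; ring.
rewrite E -natrB// subSnn mulr1 /dh mulrCA mulr_ge0//.
  by rewrite mulr_ge0 ?powR_ge0// mulr_ge0 ?powR_ge0// ltW.
have /andP[nc1 _] := nc.
by rewrite bern// divr_gt0 ?mulr_gt0 ?A0 ?powR_gt0// (lt_le_trans kp nc1).
Qed.

Hypothesis LS : forall n, 0 <= e * (1 - b * (\sum_(1 <= k < n.+2) k%:R `^ (b - 1))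
                  * weight (1 - b) n.+1).

(** Summation by parts, as an induction on [N]: the increment is S_N times [one_step] plus b^-p
    a_N^p times the Levin-Steckin defect, and the terms containing the weight cancel. Only the
    recursion of [A] below [N] is required, so [A] may be an infinite tail or a truncated one plus a
    constant. *)
Lemma telescoped (a A : nat -> R) N :
  (forall n, (0 < n)%N -> 0 < a n) -> (forall n, (0 < n <= N)%N -> 0 < A n) ->
  (forall n, (0 < n < N)%N -> A n = weight r n * a n + A n.+1) -> (0 < N)%N ->
  0 <= e * (b `^ (- p) * (\sum_(1 <= n < N) a n `^ p)
     + (\sum_(1 <= n < N) n%:R `^ (b - 1)) * (N%:R `^ (- ((1 - p) * b)) * A N `^ p)
     - \sum_(1 <= n < N) (n%:R `^ (- r) * A n) `^ p).
Proof.
move=> a0; elim: N => [//|[|N] IH] A0 AE _.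
  by rewrite !big_geq// mulr0 mul0r addr0 subr0 mulr0.
rewrite [X in _ * X + _]big_nat_recr//= [X in _ - X]big_nat_recr//=.
have {}IH := IH _ _ (ltn0Sn N).
have LSN := LS N.
have A1 : 0 < A N.+1 by apply: A0; rewrite /= leqW.
have A2 : 0 < A N.+2 by apply: A0; rewrite /= leqnn.
have := one_step (ltn0Sn N) (a0 _ (ltn0Sn N)) A2.
rewrite -AE; last by rewrite ltnS leqnn.
have -> : (N.+1%:R `^ (- r) * A N.+1) `^ p =
   N.+1%:R `^ (b - 1) * (N.+1%:R `^ (- ((1 - p) * b)) * A N.+1 `^ p).
  rewrite powRM ?powR_ge0 ?(ltW A1)// mulrA -powRDp ?ltr0n// -powRrM.
  by congr (powR _ _ * _); rewrite rE; field.
set u := _ * A N.+1 `^ p; set v := _ * A N.+2 `^ p => H.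
set S1 := \sum_(1 <= n < N.+1) n%:R `^ _ in IH *.
rewrite (_ : \sum_(1 <= n < N.+2) n%:R `^ (b - 1) = S1 + N.+1%:R `^ (b - 1))
  in LSN *; last by rewrite big_nat_recr.
have Spos : 0 <= S1 + N.+1%:R `^ (b - 1).
  by rewrite addr_ge0 ?powR_ge0// sumr_ge0// => i _; exact: powR_ge0.
have bp : 0 <= b `^ (- p) * a N.+1 `^ p by rewrite mulr_ge0 ?powR_ge0.
have {}IH : 0 <= e * (b `^ (- p) * (\sum_(1 <= n < N.+1) a n `^ p) + S1 * u -
          \sum_(1 <= n < N.+1) (n%:R `^ (- r) * A n) `^ p).
  apply: IH => n /andP[n0 nN]; first by apply: A0; rewrite n0 leqW.
  by apply: AE; rewrite n0 leqW.
set Sa := \sum_(_ <= _ < _) _ in IH *.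
set Sf := \sum_(_ <= _ < _) (_ * _) `^ p in IH *.
have := addr_ge0 IH (addr_ge0 (mulr_ge0 Spos H) (mulr_ge0 bp LSN)).
set g := N.+1%:R `^ (b - 1); set q := b `^ (- p); set z := a _ `^ p.
by congr (0 <= _); ring.
Qed.
End telescoping.

(** * Series and the three bounds *)

Section nonneg_series.
Variables (R : realType) (u : nat -> R) (m : nat).
Hypothesis u0 : forall k, (m <= k)%N -> 0 <= u k.

Lemma nneseries_leP (x : \bar R) :
  (\sum_(m <= k <oo) (u k)%:E <= x)%E <->
  forall N, ((\sum_(m <= k < N) u k)%:E <= x)%E.
Proof.
split=> [ux N|H].
  apply: le_trans ux; rewrite -sumEFin.
  by apply: nneseries_lim_ge => k mk _; rewrite lee_fin u0.
apply: lime_le.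
  by apply: is_cvg_nneseries => k mk _; rewrite lee_fin u0.
by apply: nearW => N; rewrite sumEFin.
Qed.

Lemma cvg_partial_sums (s : R) :
  (\sum_(m <= k <oo) (u k)%:E = s%:E)%E ->
  ((\sum_(m <= k < N) u k) @[N --> \oo] --> s)%classic.
Proof.
move=> E; have : cvgn (fun N => \sum_(m <= k < N) (u k)%:E)%E.
  by apply: is_cvg_nneseries => k mk _; rewrite lee_fin u0.
move/cvg_toP => /(_ _ E) /fine_cvg.
by apply: cvg_trans; apply: near_eq_cvg; apply: nearW => N /=; rewrite sumEFin.
Qed.

Lemma nneseries_tail_fin n : (m <= n)%N ->
  (\sum_(m <= k <oo) (u k)%:E \is a fin_num)%E ->
  (\sum_(n <= k <oo) (u k)%:E \is a fin_num)%E.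
Proof.
move=> mn; rewrite (@nneseries_split _ _ m (n - m)) ?subnKC//.
by rewrite fin_numD => /andP[].
Qed.

Lemma nneseries_tailS n : (m <= n)%N ->
  (\sum_(n <= k <oo) (u k)%:E = (u n)%:E + \sum_(n.+1 <= k <oo) (u k)%:E)%E.
Proof.
move=> mn; rewrite (@nneseries_split _ _ n 1) ?addn1 ?big_nat1//.
by move=> k nk; rewrite lee_fin u0// (leq_trans mn).
Qed.

End nonneg_series.

Section mean_sum.
Variables (R : realType) (p r : R) (a : nat -> R).
Hypothesis a_gt0 : positive_seq a.

Let wa_ge0 k : (1 <= k)%N -> 0 <= weight r k * a k.
Proof. by move=> k0; rewrite mulr_ge0// ltW ?weight_gt0 ?a_gt0. Qed.

Let tail n := (\sum_(n <= k <oo) (weight r k * a k)%:E)%E.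

(** Meaningful only when the series converges, since [fine] sends [+oo] to 0. *)
Definition finite_tail n := fine (tail n).

Lemma power_sum_ge0 : (0 <= power_sum p a)%E.
Proof. by apply: nneseries_ge0 => n _ _; rewrite lee_fin powR_ge0. Qed.

Lemma power_sum_ge N : ((\sum_(1 <= n < N) a n `^ p)%:E <= power_sum p a)%E.
Proof. by apply/nneseries_leP : N => // k _; exact: powR_ge0. Qed.

Lemma power_sum_leP x : (power_sum p a <= x)%E <->
  forall N, ((\sum_(1 <= n < N) a n `^ p)%:E <= x)%E.
Proof. by apply: nneseries_leP => k _; exact: powR_ge0. Qed.

Lemma mean_sum_leP x : (mean_sum p r a <= x)%E <->
  forall N, (\sum_(1 <= n < N) epow (tail_mean r a n) p <= x)%E.
Proof.
have e0 n : (0 <= epow (tail_mean r a n) p)%E.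
  by rewrite /epow; case: ifP => // _; exact: poweR_ge0.
split=> [H N|H].
  by apply: le_trans H; apply: nneseries_lim_ge.
by apply: lime_le; [exact: is_cvg_nneseries|exact: nearW].
Qed.

Section infinite.
Hypothesis tail1 : tail 1 = +oo%E.

Lemma tail_mean_pinfty n : (1 <= n)%N -> tail_mean r a n = +oo%E.
Proof.
move=> n1; rewrite /tail_mean -/(tail n).
have -> : tail n = +oo%E.
  have := tail1; rewrite /tail (@nneseries_split _ _ 1 (n - 1)) ?subnKC//.
  by rewrite sumEFin -/(tail n); case: (tail n).
by rewrite gt0_muley// lte_fin invr_gt0 powR_gt0// ltr0n.
Qed.

Lemma mean_sum_pinfty : 0 < p -> mean_sum p r a = +oo%E.
Proof.
move=> p0; apply/eqP; rewrite -leye_eq.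
have /mean_sum_leP/(_ 2) := lexx (mean_sum p r a).
by rewrite big_nat1 tail_mean_pinfty// /epow ltNge (ltW p0) andbF /= gt_eqF.
Qed.

(** The convention (+oo)^p = 0 for p < 0 makes every term vanish, so divergent tails are harmless
    for the upper bound. *)
Lemma mean_sum_eq0 : p < 0 -> (mean_sum p r a <= 0)%E.
Proof.
move=> p0; apply/mean_sum_leP => N; rewrite big_nat big1// => n /andP[n1 _].
by rewrite tail_mean_pinfty// /epow eqxx p0.
Qed.

End infinite.

Section finite.
Hypothesis tail1 : tail 1 \is a fin_num.
Local Notation A := finite_tail.

Lemma finite_tailE n : (1 <= n)%N -> tail n = (A n)%:E.
Proof. by move=> n1; rewrite fineK// (nneseries_tail_fin wa_ge0). Qed.

Lemma finite_tailS n : (1 <= n)%N -> A n = weight r n * a n + A n.+1.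
Proof.
move=> n1; apply: EFin_inj; rewrite EFinD -!finite_tailE//.
exact: (nneseries_tailS wa_ge0).
Qed.

Lemma finite_tail_gt0 n : (1 <= n)%N -> 0 < A n.
Proof.
move=> n1; rewrite finite_tailS// ltr_wpDr ?mulr_gt0 ?weight_gt0 ?a_gt0//.
by apply: fine_ge0; apply: nneseries_ge0 => k nk _; rewrite lee_fin wa_ge0// ltnW// (leq_trans _ nk).
Qed.

Lemma finite_tail_split n N : (1 <= n <= N)%N ->
  A n = \sum_(n <= k < N) weight r k * a k + A N.
Proof.
move=> /andP[n1]; elim: N => [|N IH]; first by move: n1; case: n.
rewrite leq_eqVlt => /predU1P[->|]; first by rewrite big_geq// add0r.
rewrite ltnS => nN; rewrite IH// big_nat_recr//= finite_tailS ?addrA//.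
exact: leq_trans nN.
Qed.

Lemma cvg_finite_tail n : (1 <= n)%N ->
  ((\sum_(n <= k < N) weight r k * a k) @[N --> \oo] --> A n)%classic.
Proof.
move=> n1; apply: cvg_partial_sums; last exact: finite_tailE.
by move=> k nk; rewrite wa_ge0// (leq_trans n1).
Qed.

Lemma tail_meanE n : (1 <= n)%N -> tail_mean r a n = (n%:R `^ (- r) * A n)%:E.
Proof. by move=> n1; rewrite /tail_mean -/(tail n) finite_tailE// powRN. Qed.

Lemma mean_sum_finite_leP x : (mean_sum p r a <= x)%E <->
  forall N, ((\sum_(1 <= n < N) (n%:R `^ (- r) * A n) `^ p)%:E <= x)%E.
Proof.
have E N : (\sum_(1 <= n < N) epow (tail_mean r a n) p =
    (\sum_(1 <= n < N) (n%:R `^ (- r) * A n) `^ p)%:E)%E.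
  by rewrite -sumEFin; apply: eq_big_nat => n /andP[n1 _]; rewrite tail_meanE.
split=> [/mean_sum_leP H N|H]; first by rewrite -E.
by apply/mean_sum_leP => N; rewrite E.
Qed.

End finite.
End mean_sum.

(** * The bounds for positive exponents *)

Section bounds.
Variables (R : realType) (p r b : R).
Hypothesis rE : r = p^-1 - b.

Lemma lower_bound_copson : 0 < p < 1 -> 2 <= b -> lower_bound p r (b `^ (- p)).
Proof.
move=> p01 b2 a a0; have /andP[p0 p1] := p01.
have b0 : 0 < b by apply: lt_le_trans b2; lra.
have [Tfin|] := boolP ((\sum_(1 <= k <oo) (weight r k * a k)%:E)%E \is a fin_num); last first.
  move=> Tinf; rewrite (@mean_sum_pinfty R p r a)// ?leey//.
  move: Tinf; rewrite fin_numE negb_and !negbK => /orP[|] /eqP// Tm.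
  have : (0 <= \sum_(1 <= k <oo) (weight r k * a k)%:E)%E.
    by apply: nneseries_ge0 => k k1 _; rewrite lee_fin mulr_ge0// ltW ?weight_gt0 ?a0.
  by rewrite Tm.
rewrite -lee_pdivlMl ?powR_gt0//; apply/power_sum_leP => N.
rewrite lee_pdivlMl ?powR_gt0//.
have /(mean_sum_finite_leP p a0 Tfin)/(_ N) := lexx (mean_sum p r a).
apply: le_trans; rewrite -EFinM lee_fin.
case: N => [|N]; first by rewrite !big_geq// mulr0.
have := telescoped (lt0r_neq0 p0) b0 rE (fun t => bernoulli_le p01)
  (fun n => levin_steckin_ge n b2) a0 (A := finite_tail r a) _ _ (ltn0Sn N).
rewrite mulN1r oppr_ge0 subr_le0 => H.
apply: le_trans (H _ _) => //.
- rewrite lerDl mulr_ge0//; last by rewrite mulr_ge0 ?powR_ge0.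
  by rewrite sumr_ge0// => n _; exact: powR_ge0.
- by move=> n /andP[n1 _]; exact: finite_tail_gt0.
- by move=> n /andP[n1 _]; exact: finite_tailS.
Qed.

Hypothesis b02 : 0 < b <= 2.
Let b0 : 0 < b. Proof. by case/andP: b02. Qed.

(** Tails cut at [N] vanish there, which would kill the boundary term; but [telescoped] needs
    positive tails, so a small constant [e] is added to all of them and the boundary term becomes C
    e^p. *)
Lemma truncated_upper_bound (a : nat -> R) N : 1 <= p -> positive_seq a ->
  \sum_(1 <= n < N) (n%:R `^ (- r) * \sum_(n <= k < N) weight r k * a k) `^ p
    <= b `^ (- p) * \sum_(1 <= n < N) a n `^ p.
Proof.
move=> p1 a0; have p0 : 0 < p by rewrite (lt_le_trans ltr01).
case: N => [|N]; first by rewrite !big_geq// mulr0.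
pose C := (\sum_(1 <= n < N.+1) n%:R `^ (b - 1)) * N.+1%:R `^ (- ((1 - p) * b)).
have C0 : 0 <= C by rewrite mulr_ge0 ?powR_ge0// sumr_ge0// => n _; exact: powR_ge0.
apply/ler_addgt0Pr => d d0.
have C1 : 0 < C + 1 by rewrite ltr_wpDl.
(* This makes C e^p = C d / (C + 1) <= d; the 1 guards against C = 0. *)
pose e := (d / (C + 1)) `^ p^-1.
have e0 : 0 < e by rewrite powR_gt0 ?divr_gt0.
have eE : C * e `^ p <= d.
  rewrite /e -powRrM mulVf ?gt_eqF// powRr1 ?(ltW (divr_gt0 d0 C1))//.
  by rewrite mulrA ler_pdivrMr// mulrC ler_pM2l// lerDl.
pose A n := \sum_(n <= k < N.+1) weight r k * a k + e.
have A_ge n : (0 < n)%N -> 0 <= \sum_(n <= k < N.+1) weight r k * a k.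
  move=> n0; rewrite big_nat sumr_ge0// => k /andP[nk _].
  have k0 := leq_trans n0 nk.
  by rewrite mulr_ge0// ltW ?weight_gt0 ?a0.
have := telescoped (lt0r_neq0 p0) b0 rE (fun t => bernoulli_ge (or_intror p1))
  (fun n => levin_steckin_le n b02) a0 (A := A) _ _ (ltn0Sn N).
rewrite mul1r subr_ge0 => H.
apply: (@le_trans _ _ (\sum_(1 <= n < N.+1) (n%:R `^ (- r) * A n) `^ p)).
  apply: ler_sum_nat => n /andP[n0 _].
  apply: ge0_ler_powR; rewrite ?nnegrE ?(ltW p0)// ?mulr_ge0 ?powR_ge0 ?A_ge//.
    by rewrite addr_ge0 ?A_ge// ltW.
  by rewrite ler_wpM2l ?powR_ge0// /A lerDl ltW.
apply: le_trans (H _ _) _.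
- by move=> n /andP[n0 _]; rewrite ltr_wpDl// A_ge.
- by move=> n /andP[n0 nN]; rewrite /A (big_ltn nN) addrA.
- by rewrite lerD2l mulrA [A _](_ : _ = e)// /A big_geq// add0r.
Qed.

Lemma upper_bound_copson_ge1 : 1 <= p -> upper_bound p r (b `^ (- p)).
Proof.
move=> p1 a a0; have p0 : 0 < p by rewrite (lt_le_trans ltr01).
have c0 : 0 < b `^ (- p) by rewrite powR_gt0.
have := power_sum_ge0 p a; case E : (power_sum p a) => [P| |]// P0; last first.
  by rewrite gt0_muley ?leey// lte_fin.
(* The outer sum stops at [M] and the inner one at [N], so that [N] can tend to infinity with [M]
   fixed. *)
have bound M N : (M <= N)%N ->
   \sum_(1 <= n < M) (n%:R `^ (- r) * \sum_(n <= k < N) weight r k * a k) `^ p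
     <= b `^ (- p) * P.
  move=> MN; apply: (@le_trans _ _ (b `^ (- p) * \sum_(1 <= n < N) a n `^ p)).
    apply: le_trans (truncated_upper_bound N p1 a0).
    case: M MN => [|M MN]; first by rewrite big_geq// sumr_ge0// => n _; exact: powR_ge0.
    rewrite [leRHS](@big_cat_nat _ _ _ M.+1)//= lerDl sumr_ge0// => n _; exact: powR_ge0.
  by rewrite ler_pM2l// -lee_fin -E power_sum_ge.
have Tfin : (\sum_(1 <= k <oo) (weight r k * a k)%:E)%E \is a fin_num.
  rewrite ge0_fin_numE; last first.
    by apply: nneseries_ge0 => k k1 _; rewrite lee_fin mulr_ge0// ltW ?weight_gt0 ?a0.
  apply: (@le_lt_trans _ _ ((b `^ (- p) * P) `^ p^-1)%:E); last exact: ltry.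
  apply/nneseries_leP => [k k1|N].
    by rewrite mulr_ge0// ltW ?weight_gt0 ?a0.
  rewrite lee_fin; have [N2|N2] := leqP 2 N; last first.
    by rewrite big_geq ?powR_ge0// -ltnS.
  (* The term n = 1 alone bounds all partial sums of the first tail, hence the tails are finite. *)
  have := bound _ _ N2; rewrite big_nat1 powR1 mul1r => H.
  have S0 : 0 <= \sum_(1 <= k < N) weight r k * a k.
    rewrite big_nat sumr_ge0// => k /andP[k1 _].
    by rewrite mulr_ge0// ltW ?weight_gt0 ?a0.
  rewrite -[leLHS]powRr1// -(divff (lt0r_neq0 p0)) powRrM.
  by apply: ge0_ler_powR; rewrite ?nnegrE ?powR_ge0// ?invr_ge0 ?(ltW p0)// mulr_ge0// ltW.
apply/(mean_sum_finite_leP p a0 Tfin) => M; rewrite -EFinM lee_fin.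
apply: (@cvgr_to_le _ eventually _ _ (fun N => \sum_(1 <= n < M)
  (n%:R `^ (- r) * \sum_(n <= k < N) weight r k * a k) `^ p)); last first.
  by near=> N; apply: bound; near: N; exact: nbhs_infty_ge.
(* The range of [n] becomes a condition, because the limit of each term uses n >= 1. *)
rewrite big_nat_cond.
rewrite (_ : (fun N => _) = (fun N => \sum_(1 <= n < M | (1 <= n < M)%N && true)
  (n%:R `^ (- r) * \sum_(n <= k < N) weight r k * a k) `^ p)); last first.
  by apply/funext => N; rewrite big_nat_cond.
apply: cvg_big => [|n /andP[/andP[n1 _] _]]; first exact: add_continuous.
have A0 : 0 < n%:R `^ (- r) * finite_tail r a n.
  by rewrite mulr_gt0 ?powR_gt0 ?ltr0n// finite_tail_gt0.
apply: (@continuous_cvg _ _ _ _ _ _ (fun x : R => x `^ p)).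
  apply: differentiable_continuous; apply/derivable1_diffP.
  by apply: derivable_powR; rewrite in_itv/= A0.
by apply: cvgM; [exact: cvg_cst|exact: cvg_finite_tail].
Unshelve. all: by end_near. Qed.

End bounds.

(** * The upper bound for negative exponents *)

Lemma ler_neg_powR (R : realType) (p x y : R) : p <= 0 -> 0 < x -> x <= y ->
  y `^ p <= x `^ p.
Proof.
move=> p0 x0 xy; have y0 := lt_le_trans x0 xy.
rewrite -[p]opprK powRN [leRHS]powRN lef_pV2 ?posrE ?powR_gt0//.
by apply: ge0_ler_powR; rewrite ?nnegrE ?oppr_ge0// ltW.
Qed.

(** A power mean inequality: [l] is the common value for which [k] equal terms give exactly [d], and
    Bernoulli's inequality is the tangent line of the convex function x^p at [l], summed over the
    block. *)
Lemma powR_mean_le (R : realType) (p d : R) (a : nat -> R) m k : p < 0 ->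
  0 < d -> (0 < k)%N -> (forall n, (m <= n)%N -> 0 < a n) ->
  \sum_(m <= n < m + k) a n `^ p <= d ->
  k%:R * (d / k%:R) `^ p^-1 <= \sum_(m <= n < m + k) a n.
Proof.
move=> p0 d0 k0 a0 ad.
have kR : 0 < k%:R :> R by rewrite ltr0n.
set l := (d / k%:R) `^ p^-1.
have l0 : 0 < l by rewrite powR_gt0 ?divr_gt0.
have lp : l `^ p = d / k%:R.
  by rewrite /l -powRrM mulVf ?lt_eqF// powRr1 ?ltW ?divr_gt0.
have : \sum_(m <= n < m + k) (l `^ p * (1 + p * (a n / l - 1))) <= d.
  apply: le_trans ad; apply: ler_sum_nat => n /andP[mn _].
  have an := a0 _ mn.
  have := bernoulli_ge (or_introl p0) (divr_gt0 an l0).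
  rewrite mul1r -addrA -opprD subr_ge0 -(ler_pM2l (powR_gt0 p l0)).
  by rewrite -powRM ?(ltW l0) ?(ltW (divr_gt0 an l0))// mulrCA divff ?gt_eqF// mulr1.
rewrite -mulr_sumr lp big_split/= sumr_const_nat addKn -mulr_sumr sumrB sumr_const_nat addKn.
rewrite -mulr_suml; set S := \sum_(_ <= _ < _) _.
rewrite mulrAC ler_pdivrMr// ler_pM2l// gerDl.
by rewrite nmulr_rle0// subr_ge0 ler_pdivlMr//.
Qed.

(** Levin-Steckin bounds the sum by the inverse of the integral of x^-b over [n-1, n], and that
    integral is at least n^-b. *)
Lemma power_sum_le_weight (R : realType) (b : R) n : 0 < b <= 2 -> (1 < n)%N ->
  b * (\sum_(1 <= k < n) k%:R `^ (b - 1)) <= n%:R `^ b.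
Proof.
move=> b02 n1; case: n n1 => [//|[//|n]] _; have /andP[b0 _] := b02.
have := levin_steckin_le n b02; rewrite mul1r subr_ge0.
have /andP[_] := weight_shift (1 - b) (ltn0Sn n) (ltW b0).
rewrite subrK weight1//.
have w0 := weight_gt0 (1 - b) (ltn0Sn n).
by move=> H1 H2; rewrite -(ler_pM2r w0); exact: le_trans H2 H1.
Qed.

Section negative.
Variables (R : realType) (p r b : R).
Hypotheses (rE : r = p^-1 - b) (b02 : 0 < b <= 2) (p0 : p < 0).
Let b0 : 0 < b. Proof. by case/andP: b02. Qed.

Variable a : nat -> R.
Hypothesis a0 : positive_seq a.
Hypothesis Tfin : (\sum_(1 <= k <oo) (weight r k * a k)%:E)%E \is a fin_num.
Local Notation A := (finite_tail r a).

(** On the block N <= k < 2N the weights are at least (2N)^(r-1), as r <= 1, and the sum of the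
    [a k] is bounded below by [powR_mean_le]. Raising to the negative power [p] gives a bound whose
    constant does not depend on [N]. *)
Lemma boundary_le (d : R) N : (1 < N)%N -> 0 < d ->
  \sum_(N <= n < N + N) a n `^ p <= d ->
  (\sum_(1 <= n < N) n%:R `^ (b - 1)) * (N%:R `^ (- ((1 - p) * b)) * A N `^ p)
    <= b^-1 * 2 `^ ((r - 1) * p) * d.
Proof.
move=> N1 d0 ad; have N0 : (0 < N)%N by exact: ltn_trans N1.
have NR : 0 < N%:R :> R by rewrite ltr0n.
have r0 : r - 1 <= 0.
  have : p^-1 < 0 by rewrite invr_lt0.
  by move: b0; rewrite rE; move: (p^-1) (b) => x c; lra.
have AN : (2 * N%:R) `^ (r - 1) * (N%:R * (d / N%:R) `^ p^-1) <= A N.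
  have NN : (1 <= N <= N + N)%N by rewrite N0 leq_addr.
  rewrite (finite_tail_split a0 Tfin NN).
  have := finite_tail_gt0 a0 Tfin (ltn_addr N N0).
  move=> /ltW; rewrite -(lerDl (\sum_(N <= k < N + N) weight r k * a k)); apply: le_trans.
  apply: le_trans (ler_wpM2l (powR_ge0 _ _) (powR_mean_le p0 d0 N0 _ ad)) _.
    by move=> n Nn; apply: a0; exact: leq_trans Nn.
  rewrite mulr_sumr; apply: ler_sum_nat => n /andP[Nn nN].
  have n0 : (0 < n)%N by exact: leq_trans Nn.
  rewrite ler_pM2r ?a0//.
  have r1 : 0 <= 1 - r by lra.
  have /andP[_] := weight_shift r n0 r1.
  rewrite addrC subrK weight1// mulrC -ler_pdivrMr ?powR_gt0// div1r -powRN opprB.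
  apply: le_trans; apply: ler_neg_powR => //.
  by rewrite -natrM ler_nat mul2n -addnn.
have L0 : 0 < (2 * N%:R) `^ (r - 1) * (N%:R * (d / N%:R) `^ p^-1).
  by rewrite !mulr_gt0 ?powR_gt0 ?divr_gt0 ?mulr_gt0.
have Ap := ler_neg_powR (ltW p0) L0 AN.
have S_le := power_sum_le_weight b02 N1.
rewrite mulrC -ler_pdivlMr// in S_le.
have S0 : 0 <= \sum_(1 <= n < N) n%:R `^ (b - 1) :> R.
  by apply: sumr_ge0 => n _; exact: powR_ge0.
apply: le_trans (ler_pM S0 _ S_le (ler_wpM2l (powR_ge0 _ _) Ap)) _.
  by rewrite mulr_ge0 ?powR_ge0.
have qp : ((d / N%:R) `^ p^-1) `^ p = d / N%:R.
  by rewrite -powRrM mulVf ?lt_eqF// powRr1 ?(ltW (divr_gt0 d0 NR)).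
have q0 := powR_ge0 (d / N%:R) p^-1.
move: ((d / N%:R) `^ p^-1) q0 qp => q q0 qp.
rewrite !powRM ?mulr_ge0 ?powR_ge0 ?(ltW NR)// qp -!powRrM (mulrC _ p).
set T := 2 `^ _.
rewrite le_eqVlt; apply/orP; left; apply/eqP.
transitivity (b^-1 * T * d * (N%:R `^ b * N%:R `^ (- ((1 - p) * b)) *
   N%:R `^ (p * (r - 1)) * N%:R `^ p / N%:R)); first by field; rewrite !gt_eqF.
(* The exponents of [N] add up to p(b + r) - 1 = 0. *)
rewrite -(powR_inv1 (ltW NR)) -!powRDp// (_ : _ + -1 = 0) ?powRr0 ?mulr1//.
by rewrite rE; field; rewrite lt_eqF.
Qed.

Lemma finite_upper_bound_neg (P : R) : power_sum p a = P%:E -> forall M,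
  \sum_(1 <= n < M) (n%:R `^ (- r) * A n) `^ p <= b `^ (- p) * P.
Proof.
move=> PE M; apply/ler_addgt0Pr => d d0.
pose C := b^-1 * 2 `^ ((r - 1) * p).
have C0 : 0 < C by rewrite mulr_gt0 ?invr_gt0 ?powR_gt0.
have d'0 : 0 < d / C by rewrite divr_gt0.
have cvgP := cvg_partial_sums (fun k _ => powR_ge0 (a k) p) PE.
(* Once the partial sum is within d/C of its limit, the block from [N] to 2N contributes at most
   d/C, so the boundary term is at most [d]. *)
have [N [N2 MN Nd]] : exists N, [/\ (1 < N)%N, (M <= N)%N &
   P - d / C <= \sum_(1 <= n < N) a n `^ p].
  near \oo%classic => N; exists N; split.
  - by near: N; exact: nbhs_infty_gt.
  - by near: N; exact: nbhs_infty_ge.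
  - near: N; apply: cvgr_ge cvgP _ _; lra.
have partial_le k : \sum_(1 <= n < k) a n `^ p <= P.
  by rewrite -lee_fin -PE power_sum_ge.
have block : \sum_(N <= n < N + N) a n `^ p <= d / C.
  have := partial_le (N + N)%N.
  rewrite (@big_cat_nat _ _ _ N)//= ?leq_addr ?(ltnW N2)//; lra.
have := boundary_le N2 d'0 block; rewrite -/C [C * _]mulrC divfK ?gt_eqF// => H.
have := telescoped (ltr0_neq0 p0) b0 rE (fun t => bernoulli_ge (or_introl p0))
  (fun n => levin_steckin_le n b02) a0 (A := A) (N := N) _ _ _.
rewrite mul1r subr_ge0 => T.
apply: (@le_trans _ _ (\sum_(1 <= n < N) (n%:R `^ (- r) * A n) `^ p)).
  case: M MN => [|M] MN; first by rewrite big_geq// sumr_ge0// => n _; exact: powR_ge0.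
  rewrite [leRHS](@big_cat_nat _ _ _ M.+1)//= lerDl sumr_ge0// => n _; exact: powR_ge0.
apply: le_trans (T _ _ _) _.
- by move=> n /andP[n1 _]; exact: finite_tail_gt0.
- by move=> n /andP[n1 _]; exact: finite_tailS.
- exact: ltnW.
- by rewrite lerD// ler_wpM2l ?powR_ge0.
Unshelve. all: by end_near. Qed.

End negative.

Lemma upper_bound_copson_neg (R : realType) (p r b : R) : r = p^-1 - b ->
  0 < b <= 2 -> p < 0 -> upper_bound p r (b `^ (- p)).
Proof.
move=> rE b02 p0 a a0; have /andP[b0 _] := b02.
have c0 : 0 < b `^ (- p) by rewrite powR_gt0.
have P0 := power_sum_ge0 p a.
have T0 : (0 <= \sum_(1 <= k <oo) (weight r k * a k)%:E)%E.
  by apply: nneseries_ge0 => k k1 _; rewrite lee_fin mulr_ge0// ltW ?weight_gt0 ?a0.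
have [Tfin|] := boolP ((\sum_(1 <= k <oo) (weight r k * a k)%:E)%E \is a fin_num); last first.
  rewrite ge0_fin_numE// ltey negbK => /eqP Tinf.
  by apply: le_trans (mean_sum_eq0 a0 Tinf p0) _; rewrite mule_ge0// lee_fin ltW.
move: P0; case E : (power_sum p a) => [P| |]// P0; last first.
  by rewrite gt0_muley ?leey// lte_fin.
apply/(mean_sum_finite_leP p a0 Tfin) => M.
by rewrite -EFinM lee_fin; exact: (finite_upper_bound_neg rE).
Qed.

(** * Optimality of the constant *)

Lemma powR_lt_sign (R : realType) (p x y : R) : 0 < x -> 0 < y ->
  (x `^ p < y `^ p) = (0 < p * (y - x)).
Proof.
move=> x0 y0; rewrite /powR !gt_eqF// ltr_expR.
have [p0|p0|->] := ltgtP p 0; last by rewrite !mul0r ltxx.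
  by rewrite ltr_nM2l// ltr_ln ?posrE// nmulr_rgt0// subr_lt0.
by rewrite ltr_pM2l// ltr_ln ?posrE// pmulr_rgt0// subr_gt0.
Qed.

(** * Telescoping tails and zeta sums *)

Section tails.
Variables (R : realType) (s : R).
Hypothesis s0 : 0 < s.

Lemma sum_weightN n N : (0 < n <= N)%N ->
  \sum_(n <= k < N) s * weight (- s) k = n%:R `^ (- s) - N%:R `^ (- s).
Proof.
move=> /andP[n0 nN]; rewrite (telescope_sumr_eq (fun k => - k%:R `^ (- s)))//.
  by rewrite opprK addrC.
move=> k /andP[nk _]; rewrite weightE ?(leq_trans n0)//.
rewrite /weight_primitive oppr_eq0 gt_eqF//; field.
by rewrite gt_eqF.
Qed.

Lemma nneseries_weightN n : (0 < n)%N ->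
  (\sum_(n <= k <oo) (s * weight (- s) k)%:E = (n%:R `^ (- s))%:E)%E.
Proof.
move=> n0.
have u0 k : (n <= k)%N -> 0 <= s * weight (- s) k.
  by move=> nk; rewrite mulr_ge0 ?(ltW s0)// ltW// weight_gt0// (leq_trans n0).
apply/eqP; rewrite eq_le; apply/andP; split.
  apply/nneseries_leP => // N; rewrite lee_fin.
  have [nN|Nn] := leqP n N; last by rewrite big_geq ?powR_ge0// ltnW.
  by rewrite sum_weightN ?n0// gerBl powR_ge0.
apply/lee_addgt0Pr => e e0.
have [N [nN Ne]] : exists N, (n <= N)%N /\ N%:R `^ (- s) <= e.
  (* Solves x^-s = e, so any [N] beyond [x] will do. *)
  pose x := e `^ (- s^-1).
  have x0 : 0 < x by rewrite powR_gt0.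
  exists (maxn n (Num.truncn x).+1); split; first exact: leq_maxl.
  have -> : e = x `^ (- s).
    by rewrite /x -powRrM mulrNN mulVf ?gt_eqF// powRr1// ltW.
  apply: ler_neg_powR => //; first by rewrite oppr_le0 ltW.
  rewrite (@le_trans _ _ (Num.truncn x).+1%:R)//; first by rewrite ltW// truncnS_gt.
  by rewrite ler_nat leq_maxr.
have /(nneseries_leP u0)/(_ N) := lexx (\sum_(n <= k <oo) (s * weight (- s) k)%:E)%E.
move=> /(leeD2r e%:E); apply: le_trans.
by rewrite sum_weightN ?n0// -EFinD lee_fin; lra.
Qed.
End tails.

Section zeta.
Variables (R : realType) (h : R).
Hypothesis h0 : 0 < h.

Let weight_zeta n : (0 < n)%N ->
  n.+1%:R `^ (- (1 + h)) <= weight (- h) n <= n%:R `^ (- (1 + h)).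
Proof.
move=> n0; have nR : 0 < n%:R :> R by rewrite ltr0n.
have h1 : 0 <= 1 + h by rewrite addr_ge0 ?(ltW h0).
have := weight_shift (- h) n0 h1; rewrite addrCA addNr addr0 weight1//.
rewrite !powRN => /andP[H1 H2]; apply/andP; split.
  by rewrite -div1r ler_pdivrMr ?powR_gt0// mulrC.
by rewrite -[leRHS]div1r ler_pdivlMr ?powR_gt0// mulrC.
Qed.

Lemma zeta_shift N : \sum_(1 <= n < N) n%:R `^ (- (1 + h)) <=
  1 + \sum_(1 <= n < N) n.+1%:R `^ (- (1 + h)) :> R.
Proof.
case: N => [|[|N]]; first by rewrite !big_geq// addr0.
  by rewrite !big_geq// addr0.
rewrite big_nat_recl//= powR1 lerD2l.
by rewrite [leRHS]big_nat_recr//= lerDl powR_ge0.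
Qed.

(** Integral test: the numbers [h * weight (- h) n] sum to 1 and lie between h times the shifted and
    the unshifted terms. The bound z >= 1/h forces divergence as h tends to 0. *)
Lemma zeta_value : exists2 z : R, 1 <= h * z &
  (\sum_(1 <= n <oo) (n%:R `^ (- (1 + h)))%:E = z%:E)%E.
Proof.
have u0 k : (1 <= k)%N -> 0 <= (k%:R : R) `^ (- (1 + h)) by rewrite powR_ge0.
set Z := (\sum_(1 <= n <oo) _)%E.
have w0 k : (1 <= k)%N -> 0 <= h * weight (- h) k.
  by move=> k1; rewrite mulr_ge0 ?(ltW h0)// ltW// weight_gt0.
have W1 := nneseries_weightN h0 (ltn0Sn 0); rewrite powR1 in W1.
have Zfin : (Z <= (1 + h^-1)%:E)%E.
  apply/nneseries_leP => // N; rewrite lee_fin; apply: le_trans (zeta_shift N) _.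
  rewrite lerD2l -[leRHS]mulr1 -ler_pdivrMl ?invr_gt0// invrK.
  have := lexx (1%:E : \bar R); rewrite -{1}W1 => /(nneseries_leP w0)/(_ N).
  rewrite lee_fin; apply: le_trans; rewrite mulr_sumr; apply: ler_sum_nat => n /andP[n1 _].
  by rewrite ler_pM2l//; have /andP[] := weight_zeta n1.
have Z0 : (0 <= Z)%E by apply: nneseries_ge0 => n n1 _; rewrite lee_fin powR_ge0.
case E : Z Z0 Zfin => [z| |]// _ _; exists z => //.
rewrite -lee_fin -W1; apply/nneseries_leP => // N; rewrite lee_fin -mulr_sumr ler_pM2l//.
rewrite -lee_fin -E.
apply: (@le_trans _ _ (\sum_(1 <= n < N) n%:R `^ (- (1 + h)))%:E).
  rewrite lee_fin; apply: ler_sum_nat => n /andP[n1 _].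
  by have /andP[] := weight_zeta n1.
by have /(nneseries_leP u0)/(_ N) := lexx Z.
Qed.
End zeta.

Section extremal.
Variables (R : realType) (p r b h : R).
Hypotheses (p0 : p != 0) (rE : r = p^-1 - b) (h0 : 0 < h) (s0 : 0 < b + h / p).
Let s := b + h / p.

(* Chosen so that the tail sums are exactly [n `^ (- s)], that is, so that the
   means are [n `^ (- (1 + h) / p)]. *)
Definition extremal n := s * weight (- s) n / weight r n.

Lemma extremal_gt0 : positive_seq extremal.
Proof. by move=> n n1; rewrite divr_gt0 ?mulr_gt0 ?weight_gt0. Qed.

Lemma mean_sum_extremal :
  mean_sum p r extremal = (\sum_(1 <= n <oo) (n%:R `^ (- (1 + h)))%:E)%E.
Proof.
have tailE n : (1 <= n)%N ->
    (\sum_(n <= k <oo) (weight r k * extremal k)%:E = (n%:R `^ (- s))%:E)%E.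
  move=> n1; rewrite -nneseries_weightN//; apply/congr_lim/funext => N /=.
  apply: eq_big_nat => k /andP[nk _]; congr EFin.
  by rewrite /extremal mulrC divfK// gt_eqF// weight_gt0// (leq_trans n1).
apply/congr_lim/funext => N /=; apply: eq_big_nat => n /andP[n1 _].
rewrite /tail_mean tailE// -powRN -EFinM /epow /=; congr EFin.
rewrite -powRDp ?ltr0n// -powRrM; congr powR.
by rewrite /s rE; field.
Qed.

(** The exponents [r] and [- s] differ by (1+h)/p, so [weight_shift] compares [extremal n] with s
    n^(-(1+h)/p). For p < 0 both this comparison and the power reverse, which restores the
    direction. *)
Lemma extremal_powR_le n : (0 < n)%N ->
  extremal n `^ p <= s `^ p * n%:R `^ (- (1 + h)).
Proof.
move=> n0; have wr := weight_gt0 r n0; have ws := weight_gt0 (- s) n0.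
have nR : 0 < n%:R :> R by rewrite ltr0n.
pose al := (1 + h) / p.
have sE : - s = r - al by rewrite /s /al rE; field.
have pE : - (1 + h) = (- al) * p by rewrite /al; field.
rewrite pE powRrM -powRM ?powR_ge0 ?(ltW s0)//.
have [pp|pn|E] := ltgtP 0 p; last by move: p0; rewrite -E eqxx.
  have al0 : 0 <= al by rewrite divr_ge0 ?ltW// addr_gt0.
  apply: ge0_ler_powR; rewrite ?nnegrE ?(ltW pp)// ?(ltW (extremal_gt0 n0))//.
    by rewrite mulr_ge0 ?powR_ge0 ?(ltW s0).
  rewrite /extremal -mulrA ler_pM2l// ler_pdivrMr// powRN mulrC ler_pdivlMr ?powR_gt0//.
  have /andP[+ _] := weight_shift (- s) n0 al0.
  by rewrite sE subrK mulrC.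
have al0 : 0 <= - al by rewrite oppr_ge0 mulr_ge0_le0 ?invr_le0 ?ltW// addr_gt0.
apply: ler_neg_powR; rewrite ?(ltW pn)// ?mulr_gt0 ?powR_gt0//.
rewrite /extremal -mulrA ler_pM2l// ler_pdivlMr//.
by have /andP[+ _] := weight_shift r n0 al0; rewrite sE.
Qed.

Lemma extremal_powR_ge n : (0 < n)%N -> 0 < p ->
  s `^ p * n.+1%:R `^ (- (1 + h)) <= extremal n `^ p.
Proof.
move=> n0 pp; have wr := weight_gt0 r n0; have ws := weight_gt0 (- s) n0.
pose al := (1 + h) / p.
have sE : - s = r - al by rewrite /s /al rE; field.
have pE : - (1 + h) = (- al) * p by rewrite /al; field.
rewrite pE powRrM -powRM ?powR_ge0 ?(ltW s0)//.
have al0 : 0 <= al by rewrite divr_ge0 ?ltW// addr_gt0.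
apply: ge0_ler_powR; rewrite ?nnegrE ?(ltW pp)// ?(ltW (extremal_gt0 n0))//.
  by rewrite mulr_ge0 ?powR_ge0 ?(ltW s0).
rewrite /extremal -mulrA ler_pM2l// ler_pdivlMr// powRN mulrC ler_pdivrMr ?powR_gt0//.
have /andP[_] := weight_shift (- s) n0 al0.
by rewrite sE subrK mulrC.
Qed.

Lemma power_sum_extremal_le :
  (power_sum p extremal <= (s `^ p)%:E * mean_sum p r extremal)%E.
Proof.
rewrite mean_sum_extremal; have [z _ E] := zeta_value h0; rewrite E.
apply/power_sum_leP => N; rewrite -EFinM lee_fin.
apply: (@le_trans _ _ (\sum_(1 <= n < N) s `^ p * n%:R `^ (- (1 + h)))).
  by apply: ler_sum_nat => n /andP[n1 _]; exact: extremal_powR_le.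
rewrite -mulr_sumr ler_pM2l ?powR_gt0// -lee_fin -E.
by apply/nneseries_leP : N => // k _; exact: powR_ge0.
Qed.

(** The lower estimate of the terms involves n+1 in place of n; the additive 1 is the first zeta
    term lost in this shift. *)
Lemma mean_sum_extremal_le : 0 < p ->
  (mean_sum p r extremal <= 1 + (s `^ p)^-1%:E * power_sum p extremal)%E.
Proof.
move=> pp; rewrite mean_sum_extremal.
apply/nneseries_leP => [k _|N]; first exact: powR_ge0.
have sp : 0 < s `^ p by rewrite powR_gt0.
apply: (@le_trans _ _ (1 + (s `^ p)^-1 * \sum_(1 <= n < N) extremal n `^ p)%:E).
  rewrite lee_fin; apply: le_trans (zeta_shift h N) _.
  rewrite lerD2l ler_pdivlMl// mulr_sumr; apply: ler_sum_nat => n /andP[n1 _].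
  exact: extremal_powR_ge.
rewrite EFinD EFinM leeD2l// lee_pmul2l ?lte_fin ?invr_gt0//.
exact: power_sum_ge.
Qed.
End extremal.

Lemma upper_bound_le (R : realType) (p r c c' : R) : c <= c' ->
  upper_bound p r c -> upper_bound p r c'.
Proof.
move=> cc' H a a0; apply: le_trans (H a a0) _.
by rewrite lee_wpmul2r ?power_sum_ge0// lee_fin.
Qed.

Lemma upper_bound_sharp (R : realType) (p r b c : R) : p != 0 -> 0 < b ->
  r = p^-1 - b -> c < b `^ (- p) -> ~ upper_bound p r c.
Proof.
move=> p0 b0 rE; have bp : 0 < b `^ (- p) by rewrite powR_gt0.
(* An upper bound survives enlarging [c], so [c] may be raised to a positive value still below
   b^-p. *)
wlog c0 : c / 0 < c => [wlg cb H|cb].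
  pose c1 := Num.max c (b `^ (- p) / 2).
  have c1b : c1 < b `^ (- p) by rewrite gt_max cb/=; lra.
  apply: (wlg c1 _ c1b); first by rewrite lt_max divr_gt0 ?orbT.
  by apply: upper_bound_le H; rewrite le_max lexx.
pose v := c^-1 `^ p^-1.
have v0 : 0 < v by rewrite powR_gt0 ?invr_gt0.
have vp : v `^ p = c^-1 by rewrite /v -powRrM mulVf// powRr1// invr_ge0 ltW.
have bv : 0 < p * (v - b).
  by rewrite -powR_lt_sign// vp -[b `^ p]invrK -powRN ltf_pV2 ?posrE.
(* With c = v^-p, this [h] puts the exponent b + h/p halfway between [b] and [v], so that c (b +
   h/p)^p < 1. It is positive for either sign of [p]. *)
pose h := p * (v - b) / 2.
have h0 : 0 < h by rewrite divr_gt0.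
have sE : b + h / p = (b + v) / 2 by rewrite /h; field.
have s0 : 0 < b + h / p by rewrite sE divr_gt0 ?addr_gt0.
have cs : c * (b + h / p) `^ p < 1.
  rewrite mulrC -ltr_pdivlMr// div1r -vp powR_lt_sign// sE.
  by rewrite (_ : v - _ = (v - b) / 2) ?mulrA ?divr_gt0//; field.
move=> /(_ _ (extremal_gt0 r s0)).
have := power_sum_extremal_le p0 rE h0 s0.
rewrite mean_sum_extremal//; have [z z1 ->] := zeta_value h0.
have z0 : 0 < z by rewrite -(pmulr_rgt0 _ h0) (lt_le_trans ltr01).
have := power_sum_ge0 p (extremal p r b h).
case: (power_sum _ _) => [P| |]//.
rewrite -!EFinM !lee_fin => P0 Ps zP.
have : z < z; last by rewrite ltxx.
apply: le_lt_trans zP _; apply: le_lt_trans (_ : c * ((b + h / p) `^ p * z) < z).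
  by rewrite ler_pM2l.
by rewrite mulrA -[ltRHS]mul1r ltr_pM2r.
Qed.

Lemma lower_bound_sharp (R : realType) (p r b c : R) : 0 < p -> 0 < b ->
  r = p^-1 - b -> b `^ (- p) < c -> ~ lower_bound p r c.
Proof.
move=> p0 b0 rE cb; have bp : 0 < b `^ p by rewrite powR_gt0.
pose q := c * b `^ p.
have q1 : 1 < q by rewrite /q mulrC -ltr_pdivrMl// mulr1 -powRN.
(* With this [h], the bound hz >= 1 reads (q-1)z >= 2q, whereas the assumed inequality will give
   (q-1)z <= q. *)
pose h := (q - 1) / (2 * q).
have q0 : 0 < q := lt_trans ltr01 q1.
have h0 : 0 < h by rewrite /h divr_gt0 ?subr_gt0// mulr_gt0.
have s0 : 0 < b + h / p by rewrite addr_gt0// divr_gt0.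
have bs : b `^ p <= (b + h / p) `^ p.
  by apply: ge0_ler_powR; rewrite ?nnegrE ?(ltW p0) ?(ltW b0) ?(ltW s0)// lerDl ltW// divr_gt0.
have c0 : 0 < c by apply: lt_trans cb; rewrite powR_gt0.
move=> /(_ _ (extremal_gt0 r s0)).
have := mean_sum_extremal_le (lt0r_neq0 p0) rE h0 s0 p0.
rewrite mean_sum_extremal ?gt_eqF//; have [z z1 ->] := zeta_value h0.
have := power_sum_ge0 p (extremal p r b h).
case: (power_sum _ _) => [P| |]//; last by move=> _ _; rewrite gt0_muley ?lte_fin.
set S := (b + h / p) `^ p in bs *.
have S0 : 0 < S by rewrite powR_gt0.
rewrite -EFinM -EFinM -EFinD !lee_fin => P0 zP Pz.
have z0 : 0 <= z by apply: le_trans Pz; rewrite mulr_ge0// ltW.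
have H1 : (z - 1) * q <= z.
  apply: le_trans Pz; have : z - 1 <= P / b `^ p.
    rewrite lerBlDl; apply: le_trans zP _; rewrite lerD2l mulrC.
    by rewrite ler_wpM2l// lef_pV2 ?posrE.
  by rewrite ler_pdivlMr// /q mulrCA ler_pM2l.
have H2 : 2 * q <= (q - 1) * z.
  by move: z1; rewrite /h mulrAC ler_pdivlMr ?mulr_gt0// mul1r.
lra.
Qed.

Lemma copson_constE (R : realType) (p r : R) : p != 0 -> 0 < p^-1 - r ->
  (p / (1 - r * p)) `^ p = (p^-1 - r) `^ (- p).
Proof.
move=> p0 b0; have -> : p / (1 - r * p) = (p^-1 - r)^-1.
  rewrite -[in RHS](mulfK p0 (p^-1 - r)) mulrBl mulVf// invf_div //.
by rewrite -powR_inv1 ?(ltW b0)// -powRrM mulN1r.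
Qed.

Theorem theorem1p1 (R : realType) (p r : R) :
  [/\ 0 < p < 1 -> (2 + r) * p <= 1 ->
        best_lower_bound p r ((p / (1 - r * p)) `^ p),
      1 <= p -> p^-1 - 2 <= r < p^-1 ->
        best_upper_bound p r ((p / (1 - r * p)) `^ p)
    & p < 0 -> p^-1 - 2 <= r < p^-1 ->
        best_upper_bound p r ((p / (1 - r * p)) `^ p)].
Proof.
(* With b = 1/p - r, the hypotheses on [r] become b >= 2 in the first case and 0 < b <= 2 in the
   other two. *)
have rE : r = p^-1 - (p^-1 - r) by rewrite subKr.
have bE : p^-1 - 2 <= r < p^-1 -> 0 < p^-1 - r <= 2.
  by rewrite subr_gt0 => /andP[r1 ->] /=; lra.
split=> [p01 rp|p1 /bE b02|p0 /bE b02].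
- have /andP[p0 _] := p01.
  have b2 : 2 <= p^-1 - r.
    by rewrite lerBrDr -div1r ler_pdivlMr.
  have b0 : 0 < p^-1 - r by apply: lt_le_trans b2.
  rewrite copson_constE ?gt_eqF//; split; first exact: lower_bound_copson.
  by move=> c; exact: lower_bound_sharp.
- have p0 : 0 < p := lt_le_trans ltr01 p1.
  have /andP[b0 _] := b02.
  rewrite copson_constE ?gt_eqF//; split; first exact: upper_bound_copson_ge1.
  by move=> c; apply: upper_bound_sharp => //; rewrite gt_eqF.
- have /andP[b0 _] := b02.
  rewrite copson_constE ?lt_eqF//; split; first exact: upper_bound_copson_neg.
  by move=> c; apply: upper_bound_sharp => //; rewrite lt_eqF.
Qed.
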